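(* Consider the one-dimensional OFDM signal $\mathbf{x}=\mathbf{F}_N^H\mathbf{s}$ of length $N$ with $L$ deterministic unit-amplitude pilots placed on the index set $I\subseteq\mathbb{Z}_N$ and i.i.d. random data symbols on the remaining $N-L$ indices, as set out in the context. Then for all $(k,q)\in\mathbb{Z}_N^2$, $$\mathbb{E}\left(|\mathcal{X}^{\mathrm{DP}}(k,q)|^2\right)=\begin{cases} N^2\delta_{k,0}+(\kappa-1)(N-L), & \text{if } q=0,\\ \psi(k,q), & \text{if } q\neq 0,\end{cases}$$ where $$\psi(k,q)=\left|\sum_{n=0}^{N-1}p_n\,p_{\langle n-q\rangle_N}^*\,e^{j2\pi nk/N}\right|^2+N-\sum_{n=0}^{N-1}w_n w_{\langle n-q\rangle_N}$$ $$=\left|\mathbf{p}^H\mathbf{F}_N\mathbf{\Phi}_{N,q}\mathbf{R}_{N,k}\mathbf{F}_N^H\mathbf{p}\right|^2+N-\mathbf{w}^H\mathbf{F}_N\mathbf{\Phi}_{N,q}\mathbf{F}_N^H\mathbf{w}.$$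
   Context: Let $j$ be the imaginary unit, $N\ge 1$, $0\le L\le N$, $\mathbb{Z}_N=\{0,1,\dots,N-1\}$, and $\langle\cdot\rangle_N$ denote reduction modulo $N$. All vectors and matrices are indexed from $0$. $\mathbf{F}_N$ is the normalized DFT matrix with entries $(\mathbf{F}_N)_{m,n}=\frac{1}{\sqrt N}e^{-j2\pi mn/N}$. Signal model. $I\subseteq\mathbb{Z}_N$ is a set with $L$ elements (pilot pattern). The symbol vector $\mathbf{s}\in\mathbb{C}^N$ has deterministic pilot entries $s_i$ with $|s_i|=1$ for $i\in I$ (unit-amplitude pilots), while the entries $s_i$, $i\notin I$, are i.i.d. random data symbols, each distributed as a complex random variable $d$ with finite fourth moment and $$\mathbb{E}(d)=0,\quad \mathbb{E}(|d|^2)=1,\quad \mathbb{E}(d^2)=0,\quad \mathbb{E}(d|d|^2)=\mathbb{E}(d^*|d|^2)=0.$$ The kurtosis is $\kappa=\mathbb{E}(|d|^4)$. The pilot vector $\mathbf{p}$ has $p_i=s_i$ for $i\in I$ and $p_i=0$ otherwise; the binary pilot mask $\mathbf{w}$ has $w_i=1$ for $i\in I$ and $w_i=0$ otherwise. Ambiguity function. $\mathbf{R}_{N,k}=\begin{bmatrix}\mathbf{0}&\mathbf{I}_k\\ \mathbf{I}_{N-k}&\mathbf{0}\end{bmatrix}$ is the cyclic shift, $(\mathbf{R}_{N,k}\mathbf{x})_n=x_{\langle n-k\rangle_N}$, and $\mathbf{\Phi}_{N,q}=\mathrm{Diag}(1,e^{j2\pi q/N},\dots,e^{j2\pi q(N-1)/N})$.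 The discrete periodic ambiguity function (DP-AF) is $\mathcal{X}^{\mathrm{DP}}(k,q)=\mathbf{x}^H\mathbf{R}_{N,k}^T\mathbf{\Phi}_{N,q}^*\mathbf{x}$ with $\mathbf{x}=\mathbf{F}_N^H\mathbf{s}$, for $(k,q)\in\mathbb{Z}_N^2$. $\delta_{a,b}$ is the Kronecker delta. *)

(* Defs.v *)
From HB Require Import structures.
From mathcomp Require Import all_boot all_order all_algebra.
From mathcomp Require Import spectral.
From mathcomp Require Import all_classical all_reals all_analysis.
From mathcomp Require Import complex.

Set Implicit Arguments.
Unset Strict Implicit.
Unset Printing Implicit Defensive.

Import Order.TTheory GRing.Theory Num.Theory.

Local Open Scope classical_set_scope.
Local Open Scope complex_scope.
Local Open Scope sesquilinear_scope.
Local Open Scope ring_scope.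

Section Indices.
Variable N : nat.

Lemma ord_pos (n : 'I_N) : (0 < N)%N.
Proof. exact: leq_ltn_trans (leq0n n) (ltn_ord n). Qed.

(* The index <n - k>_N; adding N first avoids truncated subtraction. *)
Definition subN (n k : 'I_N) : 'I_N :=
  Ordinal (ltn_pmod (n + (N - k)) (ord_pos n)).

End Indices.

Section Signals.
Variable R : realType.
Variable N : nat.
Local Notation C := R[i].

(* e^{j theta} *)
Definition expj (theta : R) : C := cos theta +i* sin theta.

Definition DFT : 'M[C]_N :=
  \matrix_(m, n) (((Num.sqrt (N%:R : R))^-1)%:C
                  * expj (- (2 * pi * m%:R * n%:R / N%:R))).

(* The block matrix [0, I_k; I_(N-k), 0] has k + (N - k) rows and (N - k) + k
   columns; the cast identifies both with N. *)
Definition shift_mx (k : 'I_N) : 'M[C]_N :=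
  castmx (subnKC (ltnW (ltn_ord k)), subnK (ltnW (ltn_ord k)))
    (block_mx (0 : 'M[C]_(k, N - k)) 1%:M 1%:M (0 : 'M[C]_(N - k, k))).

Definition phase_mx (q : 'I_N) : 'M[C]_N :=
  diag_mx (\row_(n < N) expj (2 * pi * q%:R * n%:R / N%:R)).

Lemma shift_mxE (k : 'I_N) (x : 'cV[C]_N) (n : 'I_N) :
  (shift_mx k *m x) n 0 = x (subN n k) 0.
Proof.
have kN := ltnW (ltn_ord k).
have kE (i j : 'I_N) : shift_mx k i j = (j == subN i k)%:R.
  rewrite /shift_mx castmxE -val_eqE /=.
  set i' := cast_ord _ i; set j' := cast_ord _ j.
  have iE : i = i' :> nat by [].
  have jE : j = j' :> nat by [].
  rewrite iE jE.
  case: (split_ordP i') => a ->; case: (split_ordP j') => b ->;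
    rewrite ?block_mxEul ?block_mxEur ?block_mxEdl ?block_mxEdr ?mxE /=.
  - rewrite modn_small; last by rewrite addnC -ltn_subRL subKn.
    by rewrite ltn_eqF// (leq_trans (ltn_ord b))// leq_addl.
  - rewrite modn_small; last by rewrite addnC -ltn_subRL subKn.
    by rewrite [in RHS]addnC eqn_add2r eq_sym.
  - rewrite addnAC subnKC// modnDl modn_small; last first.
      exact: leq_trans (ltn_ord a) (leq_subr _ _).
    by rewrite eq_sym.
  - rewrite addnAC subnKC// modnDl modn_small; last first.
      exact: leq_trans (ltn_ord a) (leq_subr _ _).
    by rewrite gtn_eqF// (leq_trans (ltn_ord a))// leq_addr.
rewrite mxE (bigD1 (subN n k))//= kE eqxx mul1r big1 ?addr0// => j jn.
by rewrite kE (negPf jn) mul0r.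
Qed.

Definition ofdm (s : 'cV[C]_N) : 'cV[C]_N := DFT ^t* *m s.

Definition dpaf (x : 'cV[C]_N) (k q : 'I_N) : C :=
  (x ^t* *m (shift_mx k)^T *m map_mx Num.conj (phase_mx q) *m x) 0 0.

Definition pilot_vec (I : {set 'I_N}) (s : 'cV[C]_N) : 'cV[C]_N :=
  \col_i (if i \in I then s i 0 else 0).

Definition pilot_mask (K : pzRingType) (I : {set 'I_N}) : 'cV[K]_N :=
  \col_i (i \in I)%:R.

Definition psi (I : {set 'I_N}) (p : 'cV[C]_N) (k q : 'I_N) : R :=
  let w := pilot_mask R I in
  Normc.normc (\sum_(n < N) p n 0 * (p (subN n q) 0)^*
                 * expj (2 * pi * n%:R * k%:R / N%:R)) ^+ 2
  + N%:R - \sum_(n < N) w n 0 * w (subN n q) 0.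

End Signals.

Section ComplexRandomVariables.
Variable R : realType.
Local Notation C := R[i].

(* C carries the sigma-algebra transported from R * R. *)
Definition to_plane (z : C) : R * R := (complex.Re z, complex.Im z).

Definition complex_RV d (T : measurableType d) (X : T -> C) : Prop :=
  measurable_fun setT (to_plane \o X).

(* Meaningful only when Re X and Im X are integrable. *)
Definition cexpectation d (T : measurableType d) (P : probability T R)
    (X : T -> C) : C :=
  fine ('E_P[fun t => complex.Re (X t)])%E +i* fine ('E_P[fun t => complex.Im (X t)])%E.

Definition same_law d (T : measurableType d) (P : probability T R) (X : T -> C)
    d' (T' : measurableType d') (P' : probability T' R) (Y : T' -> C) : Prop :=
  forall A : set (R * R), measurable A ->
    P ((to_plane \o X) @^-1` A) = P' ((to_plane \o Y) @^-1` A).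

Definition mutually_independent (J : finType) d (T : measurableType d)
    (P : probability T R) (D : {set J}) (X : J -> T -> C) : Prop :=
  forall E : {set J}, E \subset D ->
  forall A : J -> set (R * R), (forall j, measurable (A j)) ->
    P (\bigcap_(j in [set` E]) ((to_plane \o X j) @^-1` A j))
    = (\prod_(j in E) P ((to_plane \o X j) @^-1` A j))%E.

Definition iid_copies (J : finType) d (T : measurableType d)
    (P : probability T R) (D : {set J}) (X : J -> T -> C)
    d' (T' : measurableType d') (P' : probability T' R) (Y : T' -> C) : Prop :=
  [/\ forall j, j \in D -> complex_RV (X j),
      forall j, j \in D -> same_law P (X j) P' Y
    & mutually_independent P D X].

Definition kurtosis d (T : measurableType d) (P : probability T R)
    (X : T -> C) : R :=
  fine ('E_P[fun t => (Normc.normc (X t) ^+ 4)%R])%E.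

End ComplexRandomVariables.

(* Main.v *)
Require Import Defs.
From HB Require Import structures.
From mathcomp Require Import all_boot all_order all_algebra.
From mathcomp Require Import spectral.
From mathcomp Require Import all_classical all_reals all_analysis.
From mathcomp Require Import finmap measurable_realfun.
From mathcomp Require Import complex ring lra.

Import Order.TTheory GRing.Theory Num.Theory.

Local Open Scope classical_set_scope.
Local Open Scope complex_scope.
Local Open Scope sesquilinear_scope.
Local Open Scope ring_scope.

(* By orthogonality of the Fourier vectors, the ambiguity function of an OFDM
   signal is, up to a unimodular factor,
     A = sum_n s_n conj(s_(n-q)) e^(2 pi j n k / N).
   Expanding |A|^2 produces the moments
     E[s_n conj(s_(n-q)) conj(s_(n')) s_(n'-q)],
   which by independence are products over the indices m of moments
   E[s_m^a conj(s_m)^b] with a, b <= 2.  For q <> 0 and n <> n', an index that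
   occurs at all occurs only conjugated or only unconjugated, so a single data
   index makes the moment vanish; for n = n' the moment is 1.  For q = 0 the
   moment is E[|s_n|^2 |s_(n')|^2], which is 1 except that it is kappa when
   n = n' is a data index.

   The factorization of the expectation is obtained for nonnegative functions by
   replacing indicators with general functions one index at a time (monotone
   convergence), then for complex ones by multilinear expansion. *)

(** * Expectations of products of nonnegative functions of independent variables *)

Section Independence.
Import HBNNSimple.

(** Linearity carries the equality from indicators to nonnegative simple functions, and monotone
    convergence carries it to their limits. A weight can thus be exchanged after a test on
    indicators only. *)
Lemma eq_ge0_integral_weight {d d' : measure_display} {T : measurableType d}
    {Y : measurableType d'} {R : realType} (mu : {measure set T -> \bar R})
    (Z : T -> Y) (g1 g2 : T -> R) (f : Y -> R) :
  measurable_fun setT Z ->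
  measurable_fun setT g1 -> (forall t, 0 <= g1 t) ->
  measurable_fun setT g2 -> (forall t, 0 <= g2 t) ->
  (forall A, measurable A -> \int[mu]_t (\1_A (Z t) * g1 t)%:E
                           = \int[mu]_t (\1_A (Z t) * g2 t)%:E)%E ->
  measurable_fun setT f -> (forall y, 0 <= f y) ->
  (\int[mu]_t (f (Z t) * g1 t)%:E = \int[mu]_t (f (Z t) * g2 t)%:E)%E.
Proof.
move=> mZ mg1 g10 mg2 g20 eqI mf f0.
have mF : measurable_fun setT (EFin \o f) by exact/measurable_EFinP.
pose f_ := nnsfun_approx measurableT mF.
have approx (g : T -> R) : measurable_fun setT g -> (forall t, 0 <= g t) ->
    (\int[mu]_t (f (Z t) * g t)%:E
     = limn (fun n => \int[mu]_t (f_ n (Z t) * g t)%:E))%E.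
  move=> mg g0; rewrite -monotone_convergence//=.
  - apply: eq_integral => t _; apply/esym/cvg_lim => //.
    under eq_fun do rewrite EFinM.
    rewrite EFinM; apply: cvgeZr => //.
    by apply: cvg_nnsfun_approx => // y _; rewrite lee_fin.
  - move=> n; apply/measurable_EFinP; apply: measurable_funM => //.
    exact: measurableT_comp.
  - by move=> n t _; rewrite lee_fin mulr_ge0.
  - move=> t _ m n mn; rewrite lee_fin ler_wpM2r//.
    exact/lefP/nd_nnsfun_approx.
rewrite !approx//; congr (limn _); apply/funext => n.
have simple (g : T -> R) : measurable_fun setT g -> (forall t, 0 <= g t) ->
    (\int[mu]_t (f_ n (Z t) * g t)%:E
     = \sum_(i < #|` fset_set (f_ n @` setT)|)
         ((fset_set (f_ n @` setT))`_i)%:E *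
         \int[mu]_t (\1_(f_ n @^-1` [set (fset_set (f_ n @` setT))`_i]) (Z t) * g t)%:E)%E.
  move=> mg g0; set s := fset_set _.
  have s0 (i : 'I_#|` s|) : 0 <= s`_i.
    have : s`_i \in s by exact: mem_nth.
    rewrite in_fset_set; last exact: fimfunP.
    by move=> /set_mem[y _ <-].
  under eq_integral do rewrite fimfunEord mulr_suml -sumEFin.
  have mi (i : 'I_#|` s|) : measurable_fun setT
      (fun t => \1_(f_ n @^-1` [set s`_i]) (Z t) * g t).
    apply: measurable_funM => //; apply: measurableT_comp => //.
  rewrite ge0_integral_sum//=.
  - apply: eq_bigr => i _.
    under eq_integral do rewrite -mulrA EFinM.
    rewrite ge0_integralZl_EFin//; last exact/measurable_EFinP.
    by move=> t _; rewrite lee_fin mulr_ge0.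
  - move=> i; apply/measurable_EFinP.
    under eq_fun do rewrite -mulrA.
    exact: measurable_funM.
  - by move=> i t _; rewrite lee_fin !mulr_ge0.
by rewrite !simple//; apply: eq_bigr => i _; rewrite eqI.
Qed.

Lemma integral_indic_comp {d d' : measure_display} {T : measurableType d}
    {Y : measurableType d'} {R : realType} (mu : {measure set T -> \bar R})
    (Z : T -> Y) (A : set Y) : measurable_fun setT Z -> measurable A ->
  (\int[mu]_t (\1_A (Z t))%:E = mu (Z @^-1` A))%E.
Proof.
move=> mZ mA; rewrite -[in RHS](setIT (Z @^-1` A)) -integral_indic//.
by rewrite -[X in measurable X]setTI; exact: mZ.
Qed.

Lemma expectation_prod_indep {d d' : measure_display} {T : measurableType d}
    {Y : measurableType d'} {R : realType} (P : probability T R)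
    (J : finType) (D : {set J}) (Z : J -> T -> Y) :
  (forall j, j \in D -> measurable_fun setT (Z j)) ->
  (forall A : J -> set Y, (forall j, measurable (A j)) ->
    P (\bigcap_(j in [set` D]) (Z j @^-1` A j))
    = (\prod_(j in D) P (Z j @^-1` A j))%E) ->
  forall (f : J -> Y -> R) (m : J -> R),
  (forall j, measurable_fun setT (f j)) -> (forall j y, 0 <= f j y) ->
  (forall j, j \in D -> \int[P]_t (f j (Z j t))%:E = (m j)%:E)%E ->
  (\int[P]_t (\prod_(j in D) f j (Z j t))%:E = (\prod_(j in D) m j)%:E)%E.
Proof.
move=> mZ indep f m mf f0 fm.
(* [E] collects the indices that carry a general function, all other factors being indicators: [E]
   empty is the independence hypothesis, and [E = D] is the claim. *)
suff H n : forall (E : {set J}) (A : J -> set Y) (f : J -> Y -> R) (m : J -> R),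
    #|E| = n -> E \subset D -> (forall j, measurable (A j)) ->
    (forall j, measurable_fun setT (f j)) -> (forall j y, 0 <= f j y) ->
    (forall j, j \in D -> \int[P]_t (f j (Z j t))%:E = (m j)%:E)%E ->
    (forall j, j \in D :\: E -> f j = \1_(A j)) ->
    (\int[P]_t (\prod_(j in D) f j (Z j t))%:E = (\prod_(j in D) m j)%:E)%E.
  by apply: (H #|D| D (fun=> setT)) => // j; rewrite finset.setDv inE.
elim: n => [|n IH] E A {mf f0 fm}f {}m cE ED mA mf f0 fm fA.
  have E0 : E = finset.set0 by apply/eqP; rewrite -cards_eq0 cE.
  have {}fA j : j \in D -> f j = \1_(A j) by move=> jD; rewrite fA// E0 finset.setD0.
  have mcap j : j \in D -> measurable (Z j @^-1` A j).
    by move=> jD; rewrite -[X in measurable X]setTI; exact: mZ.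
  have -> : (fun t => (\prod_(j in D) f j (Z j t))%:E)
          = EFin \o \1_(\bigcap_(j in [set` D]) (Z j @^-1` A j)).
    apply/funext => t /=; congr EFin; rewrite indicE.
    have [tA|tA] := boolP (t \in _).
      rewrite big1// => j jD; rewrite fA// indicE mem_set//.
      exact: (set_mem tA).
    move: tA; rewrite notin_setE => tA.
    have [j /andP[jD jA]] : exists j, (j \in D) && (Z j t \notin A j).
      apply/existsP; apply/contra_notT: tA; rewrite negb_exists => /forallP tA j /= jD.
      by have := tA j; rewrite jD/= negbK => /set_mem.
    by rewrite (bigD1 j)//= fA// indicE (negPf jA) mul0r.
  rewrite integral_indic//; last by apply: fin_bigcap_measurable => //.
  rewrite setIT.
  apply: etrans (indep A mA) _; rewrite -prodEFin; apply: eq_bigr => j jD.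
  by rewrite -fm// fA// integral_indic_comp//; exact: mZ.
have [a aE] : exists a, a \in E by apply/set0Pn; rewrite -cards_eq0 cE.
have aD : a \in D by exact: (fintype.subsetP ED).
have m0 j : j \in D -> 0 <= m j.
  by move=> jD; rewrite -lee_fin -fm//; apply: integral_ge0 => t _; rewrite lee_fin.
rewrite (bigD1 a)//=; under eq_integral do rewrite (bigD1 a)//=.
have mfZ j : j \in D -> measurable_fun setT (fun t => f j (Z j t)).
  by move=> jD; apply: measurableT_comp => //; exact: mZ.
(* The factors other than [a] form the weight, to be exchanged for the constant product of their
   means; what remains is the same identity with an indicator at [a]. *)
rewrite (@eq_ge0_integral_weight _ _ _ _ _ P (Z a) _
  (cst (\prod_(j in D | j != a) m j)))//=.
- under eq_integral do rewrite mulrC EFinM.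
  rewrite ge0_integralZl_EFin//.
  + by rewrite fm// mulrC EFinM.
  + by move=> t _; rewrite lee_fin.
  + by apply/measurable_EFinP; exact: mfZ.
  + by apply: prodr_ge0 => j /andP[jD _]; exact: m0.
- exact: mZ.
- under eq_fun do rewrite -big_filter.
  by apply: measurable_prod => j; rewrite mem_filter => /andP[/andP[jD _] _]; exact: mfZ.
- by move=> t; apply: prodr_ge0.
- by move=> _; apply: prodr_ge0 => j /andP[jD _]; exact: m0.
- move=> B mB.
  have PB : (P (Z a @^-1` B)) \is a fin_num.
    by rewrite fin_num_measure// -[X in measurable X]setTI; exact: mZ.
  (* Index [a] now carries the indicator of [B], whose mean is the probability that [Z a] lies in
     [B]; one general function fewer is left. *)
  have := IH (E :\ a) (fun j => if j == a then B else A j)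
    (fun j => if j == a then \1_B else f j)
    (fun j => if j == a then fine (P (Z a @^-1` B)) else m j).
  rewrite (bigD1 a)//= eqxx.
  under eq_integral do rewrite (bigD1 a)//= eqxx.
  have eqb (h1 h2 : J -> R) : \prod_(j in D | j != a) (if j == a then h1 j else h2 j)
      = \prod_(j in D | j != a) h2 j.
    by apply: eq_bigr => j /andP[_ /negPf ->].
  rewrite eqb => IHB; transitivity (fine (P (Z a @^-1` B)) * \prod_(j in D | j != a) m j)%:E.
    rewrite -IHB.
    + apply: eq_integral => t _; congr (_ * _)%:E.
      by apply: eq_bigr => j /andP[_ /negPf ->].
    + by move: cE; rewrite (cardsD1 a) aE => -[].
    + exact: fintype.subset_trans (subD1set _ _) ED.
    + by move=> j; case: ifP.
    + by move=> j; case: (j == a).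
    + by move=> j y; case: ifP.
    + move=> j jD; case: ifPn => [/eqP ->|_]; last exact: fm.
      by rewrite integral_indic_comp ?fineK//; exact: mZ.
    + move=> j; rewrite !inE negb_and negbK; case: ifP => //= _ /andP[jE jD].
      by apply: fA; rewrite inE jE.
  under [RHS]eq_integral do rewrite mulrC EFinM.
  rewrite ge0_integralZl_EFin//.
  + rewrite integral_indic_comp//; last exact: mZ.
    by rewrite mulrC EFinM fineK.
  + apply/measurable_EFinP; apply: measurableT_comp; last exact: mZ.
    exact: measurable_indic.
  + by apply: prodr_ge0 => j /andP[jD _]; exact: m0.
Qed.

End Independence.

(** * Calculus of real and complex expectations *)

Section ComplexExpectation.
Set Implicit Arguments.
Unset Strict Implicit.
Unset Printing Implicit Defensive.
Context {d : measure_display} {T : measurableType d} {R : realType}.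
Variable P : probability T R.
Local Notation C := R[i].

(** Integrability travels with the value: [fine] turns an infinite expectation into 0, so values
    alone would not be additive. *)
Definition has_expectation (f : T -> R) (m : R) : Prop :=
  P.-integrable setT (EFin \o f) /\ (\int[P]_t (f t)%:E = m%:E)%E.

Definition has_cexpectation (X : T -> C) (v : C) : Prop :=
  has_expectation (fun t => complex.Re (X t)) (complex.Re v) /\
  has_expectation (fun t => complex.Im (X t)) (complex.Im v).

Lemma eq_has_expectation (f g : T -> R) m :
  f =1 g -> has_expectation f m -> has_expectation g m.
Proof. by move/funext=> ->. Qed.

Lemma has_expectation_fine (f : T -> R) :
  P.-integrable setT (EFin \o f) -> has_expectation f (fine ('E_P[f]))%E.
Proof.
by move=> If; split=> //; rewrite unlock fineK//; exact: integrable_fin_num.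
Qed.

Lemma has_expectationD (f g : T -> R) a b :
  has_expectation f a -> has_expectation g b ->
  has_expectation (fun t => f t + g t) (a + b).
Proof.
move=> [If fa] [Ig gb]; split; first exact: (integrableD measurableT If Ig).
by rewrite -[RHS]/(a%:E + b%:E)%E -fa -gb -integralD_EFin.
Qed.

Lemma has_expectationZ (k : R) (f : T -> R) a :
  has_expectation f a -> has_expectation (fun t => k * f t) (k * a).
Proof.
move=> [If fa]; split; first exact: (integrableZl measurableT k If).
rewrite -[RHS]/(k%:E * a%:E)%E -fa -integralZl//.
Qed.

Lemma has_expectation_unique (f : T -> R) a b :
  has_expectation f a -> has_expectation f b -> a = b.
Proof. by move=> [_ fa] [_]; rewrite fa => -[]. Qed.

Lemma has_cexpectation_unique (X : T -> C) u v :
  has_cexpectation X u -> has_cexpectation X v -> u = v.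
Proof.
case: u v => [a b] [a' b'] [Xa Xb] [Xa' Xb'].
have /= -> := has_expectation_unique Xa Xa'.
by have /= -> := has_expectation_unique Xb Xb'.
Qed.

Lemma has_cexpectation_real (f : T -> R) m :
  has_expectation f m -> has_cexpectation (fun t => (f t)%:C) m%:C.
Proof.
move=> fm; split=> //=; rewrite /comp/=; split; first exact: integrable0.
exact: integral0.
Qed.

Lemma has_cexpectation_cst (c : C) : has_cexpectation (fun=> c) c.
Proof.
by split; split=> /=; rewrite ?integral_cst//= ?probability_setT ?mule1//;
  exact: finite_measure_integrable_cst.
Qed.

Lemma has_cexpectationD (X Y : T -> C) u v :
  has_cexpectation X u -> has_cexpectation Y v ->
  has_cexpectation (fun t => X t + Y t) (u + v).
Proof.
have ReD (x y : C) : complex.Re (x + y) = complex.Re x + complex.Re y.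
  by case: x y => ? ? [? ?].
have ImD (x y : C) : complex.Im (x + y) = complex.Im x + complex.Im y.
  by case: x y => ? ? [? ?].
move=> [Xr Xi] [Yr Yi]; split.
  rewrite ReD; apply: (eq_has_expectation (fun t => esym (ReD _ _))).
  exact: has_expectationD.
rewrite ImD; apply: (eq_has_expectation (fun t => esym (ImD _ _))).
exact: has_expectationD.
Qed.

Lemma has_cexpectationZ (c : C) (X : T -> C) v :
  has_cexpectation X v -> has_cexpectation (fun t => c * X t) (c * v).
Proof.
have ReM (x y : C) : complex.Re (x * y)
    = complex.Re x * complex.Re y + - complex.Im x * complex.Im y.
  by case: x y => ? ? [? ?] /=; rewrite mulNr.
have ImM (x y : C) : complex.Im (x * y)
    = complex.Re x * complex.Im y + complex.Im x * complex.Re y by case: x y => ? ? [? ?].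
move=> [Xr Xi]; split.
  rewrite ReM; apply: (eq_has_expectation (fun t => esym (ReM _ _))).
  by apply: has_expectationD; exact: has_expectationZ.
rewrite ImM; apply: (eq_has_expectation (fun t => esym (ImM _ _))).
by apply: has_expectationD; exact: has_expectationZ.
Qed.

Lemma has_cexpectation_sum (J : Type) (r : seq J) (Q : pred J) (X : J -> T -> C) v :
  (forall j, Q j -> has_cexpectation (X j) (v j)) ->
  has_cexpectation (fun t => \sum_(j <- r | Q j) X j t) (\sum_(j <- r | Q j) v j).
Proof.
move=> Xv; elim: r => [|j r IH].
  by rewrite big_nil; under eq_fun do rewrite big_nil; exact: has_cexpectation_cst.
rewrite big_cons; under eq_fun do rewrite big_cons.
by case: ifPn => // Qj; apply: has_cexpectationD => //; exact: Xv.
Qed.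

Lemma has_cexpectation_conj (X : T -> C) v :
  has_cexpectation X v -> has_cexpectation (fun t => (X t)^*) v^*.
Proof.
have ReJ (x : C) : complex.Re x^* = complex.Re x by case: x.
have ImJ (x : C) : complex.Im x^* = - 1 * complex.Im x by case: x => ? ? /=; rewrite mulN1r.
move=> [Xr Xi]; split.
  by rewrite ReJ; apply: (eq_has_expectation (fun t => esym (ReJ _))).
rewrite ImJ; apply: (eq_has_expectation (fun t => esym (ImJ _))).
exact: has_expectationZ.
Qed.

End ComplexExpectation.

(** * Measurability of complex random variables *)

Section ComplexMeasurability.
Context {d : measure_display} {T : measurableType d} {R : realType}.
Set Implicit Arguments.
Unset Strict Implicit.
Unset Printing Implicit Defensive.
Local Notation C := R[i].

Lemma complex_RVP (X : T -> C) : complex_RV X <->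
  measurable_fun setT (fun t => complex.Re (X t)) /\
  measurable_fun setT (fun t => complex.Im (X t)).
Proof.
split=> [mX|[mr mi]]; last exact: measurable_fun_pair.
by split; [exact: (measurableT_comp measurable_fst mX)
          |exact: (measurableT_comp measurable_snd mX)].
Qed.

Lemma complex_RV_cst (c : C) : complex_RV (fun _ : T => c).
Proof. by apply/complex_RVP; split; exact: measurable_cst. Qed.

Lemma complex_RVM (X Y : T -> C) :
  complex_RV X -> complex_RV Y -> complex_RV (fun t => X t * Y t).
Proof.
move=> /complex_RVP[Xr Xi] /complex_RVP[Yr Yi]; apply/complex_RVP; split.
  rewrite (_ : (fun t => _) = fun t => complex.Re (X t) * complex.Re (Y t)
                                     - complex.Im (X t) * complex.Im (Y t)).
    by apply: measurable_funB; exact: measurable_funM.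
  by apply/funext => t; case: (X t) (Y t) => ? ? [].
rewrite (_ : (fun t => _) = fun t => complex.Re (X t) * complex.Im (Y t)
                                   + complex.Im (X t) * complex.Re (Y t)).
  by apply: measurable_funD; exact: measurable_funM.
by apply/funext => t; case: (X t) (Y t) => ? ? [].
Qed.

Lemma complex_RVX (X : T -> C) n : complex_RV X -> complex_RV (fun t => X t ^+ n).
Proof.
move=> mX; elim: n => [|n IH]; first exact: complex_RV_cst.
by under eq_fun do rewrite exprS; exact: complex_RVM.
Qed.

Lemma complex_RV_conj (X : T -> C) : complex_RV X -> complex_RV (fun t => (X t)^*).
Proof.
move=> /complex_RVP[Xr Xi]; apply/complex_RVP; split.
  rewrite (_ : (fun t => _) = fun t => complex.Re (X t))//.
  by apply/funext => t; case: (X t).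
rewrite (_ : (fun t => _) = fun t => - complex.Im (X t)).
  exact: measurable_funN.
by apply/funext => t; case: (X t).
Qed.

End ComplexMeasurability.

(** * Decomposition of a complex number into four nonnegative reals *)

Section Quarters.
Context {R : realType}.
Local Notation C := R[i].

(** Measurability of a function of a complex variable is expressed by composing it with this inverse
    of [to_plane]. *)
Definition of_plane (y : R * R) : C := y.1 +i* y.2.

Lemma to_planeK : cancel (@to_plane R) of_plane.
Proof. by case. Qed.

(* The positive parts of [Re z], [Im z], [- Re z] and [- Im z]: writing every
   factor of a product through them leaves only nonnegative real factors. *)
Definition quarter (a : 'I_4) (z : C) : R :=
  Num.max (complex.Re ((- 'i%C) ^+ a * z)) 0.

Lemma quarter_ge0 a z : 0 <= quarter a z.
Proof. by rewrite le_max lexx orbT. Qed.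

(** The even powers of [i] recombine the positive and negative parts of the real part, the odd
    powers those of the imaginary part. *)
Lemma quarterE z : z = \sum_(a < 4) 'i%C ^+ a * (quarter a z)%:C.
Proof.
rewrite !big_ord_recl big_ord0 /quarter /=; case: z => x y.
have maxN (u : R) : u = Num.max u 0 - Num.max (- u) 0.
  rewrite /Num.max oppr_lt0.
  by case: (ltgtP u 0) => [||->]; rewrite ?subr0 ?opprK ?add0r ?oppr0.
rewrite /bump /= !expr1 !expr0 !mul1r !exprS !expr0 !mulr1 /=; simpc.
by apply/eqP; rewrite eq_complex/= -!maxN !eqxx.
Qed.

Lemma measurable_quarter d (T : measurableType d) (a : 'I_4) (X : T -> C) :
  complex_RV X -> measurable_fun setT (fun t => quarter a (X t)).
Proof.
move=> mX; apply: measurable_maxr => //.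
by have /complex_RVP[] := complex_RVM (complex_RV_cst ((- 'i%C) ^+ a)) mX.
Qed.

End Quarters.

(** * Complex products of independent factors, and transfer along equal laws *)

Section IndependentProduct.
Context {d : measure_display} {T : measurableType d} {R : realType}.
Set Implicit Arguments.
Unset Strict Implicit.
Unset Printing Implicit Defensive.
Variable P : probability T R.
Local Notation C := R[i].

Lemma has_expectation_ge0 (f : T -> R) m : measurable_fun setT f ->
  (forall t, 0 <= f t) -> (\int[P]_t (f t)%:E = m%:E)%E -> has_expectation P f m.
Proof.
move=> mf f0 fm; split=> //; apply/integrableP; split; first exact/measurable_EFinP.
by under eq_integral do rewrite gee0_abs ?lee_fin//; rewrite fm ltry.
Qed.

Lemma integrable_max0 (f : T -> R) : P.-integrable setT (EFin \o f) ->
  P.-integrable setT (EFin \o (fun t => Num.max (f t) 0)).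
Proof.
move=> If; have := integrable_funepos measurableT If.
by congr (integrable _ _ _); apply/funext => t /=; rewrite funeposE /= EFin_max.
Qed.

Lemma has_expectation_quarter (a : 'I_4) (X : T -> C) v : has_cexpectation P X v ->
  exists m, has_expectation P (fun t => quarter a (X t)) m.
Proof.
move=> Xv; eexists; apply: has_expectation_fine.
apply: integrable_max0.
by have [[]] := has_cexpectationZ ((- 'i%C) ^+ a) Xv.
Qed.

(** Splitting every factor into quarters and distributing leaves a linear combination of products of
    nonnegative functions, each covered by [expectation_prod_indep]; the product of the [v j] has
    the same expansion. *)
Lemma has_cexpectation_prod (J : finType) (D : {set J}) (X : J -> T -> C)
    (F : J -> C -> C) (v : J -> C) :
  (forall j, j \in D -> complex_RV (X j)) -> mutually_independent P D X ->
  (forall j, complex_RV (fun y => F j (of_plane y))) ->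
  (forall j, j \in D -> has_cexpectation P (fun t => F j (X j t)) (v j)) ->
  has_cexpectation P (fun t => \prod_(j in D) F j (X j t)) (\prod_(j in D) v j).
Proof.
move=> mX indep mF Fv.
pose f (a : 'I_4) j y := quarter a (F j (of_plane y)).
have fE a j t : f a j (to_plane (X j t)) = quarter a (F j (X j t)).
  by rewrite /f to_planeK.
(* The means of all quarters are chosen at once; off [D] the value 0 is a dummy. *)
have [m mP] : exists m : 'I_4 -> J -> R, forall a j, j \in D ->
    has_expectation P (fun t => quarter a (F j (X j t))) (m a j).
  have /(_ _)/cid mex (aj : 'I_4 * J) : exists m, aj.2 \in D ->
      has_expectation P (fun t => quarter aj.1 (F aj.2 (X aj.2 t))) m.
    have [jD|jD] := boolP (aj.2 \in D); last by exists 0.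
    by have [m mP] := has_expectation_quarter aj.1 (Fv _ jD); exists m.
  by exists (fun a j => sval (mex (a, j))) => a j; exact: (svalP (mex (a, j))).
have vE j : j \in D -> v j = \sum_(a < 4) 'i%C ^+ a * (m a j)%:C.
  move=> jD; apply: has_cexpectation_unique (Fv j jD) _.
  under eq_fun do rewrite [F j _]quarterE.
  apply: has_cexpectation_sum => a _; apply: has_cexpectationZ.
  by apply: has_cexpectation_real; exact: mP.
rewrite (eq_bigr _ vE).
rewrite (_ : (fun t => _) = fun t =>
  \prod_(j in D) \sum_(a < 4) 'i%C ^+ a * (f a j (to_plane (X j t)))%:C); last first.
  apply/funext => t; apply: eq_bigr => j _; rewrite [LHS]quarterE.
  by apply: eq_bigr => a _; rewrite fE.
(* Both products of sums are expanded over the maps [a] choosing a quarter at each index; [ord0] is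
   the value of such a map off [D]. *)
rewrite (big_distr_big_dep ord0).
under eq_fun do rewrite (big_distr_big_dep ord0).
apply: has_cexpectation_sum => a _.
rewrite big_split/=; under eq_fun do rewrite big_split/=.
apply: has_cexpectationZ.
rewrite -rmorph_prod; under eq_fun do rewrite -rmorph_prod.
have mf j : measurable_fun setT (f (a j) j) by apply: measurable_quarter.
apply: has_cexpectation_real; apply: has_expectation_ge0.
- under eq_fun do rewrite -big_filter.
  apply: measurable_prod => j; rewrite mem_filter => /andP[jD _].
  by apply: measurableT_comp => //; exact: mX.
- by move=> t; apply: prodr_ge0 => j _; exact: quarter_ge0.
- apply: (expectation_prod_indep P _ D (fun j => @to_plane R \o X j) _ _
    (fun j => f (a j) j) (fun j => m (a j) j)) => //.
  + by move=> A mA; apply: indep.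
  + by move=> j y; exact: quarter_ge0.
  + by move=> j jD; have [_ <-] := mP (a j) j jD; apply: eq_integral => t _; rewrite fE.
Qed.

(** By change of variables both expectations are integrals over the plane, against image measures
    that agree on measurable sets. *)
Lemma has_cexpectation_same_law d' (T' : measurableType d') (P' : probability T' R)
    (X : T -> C) (Y : T' -> C) (F : C -> C) v :
  complex_RV X -> complex_RV Y -> same_law P X P' Y ->
  complex_RV (fun y => F (of_plane y)) ->
  has_cexpectation P' (fun t => F (Y t)) v -> has_cexpectation P (fun t => F (X t)) v.
Proof.
move=> mX mY law /complex_RVP[mr mi].
have step (f : C -> R) m : measurable_fun setT (fun y => f (of_plane y)) ->
    has_expectation P' (fun t => f (Y t)) m -> has_expectation P (fun t => f (X t)) m.
  move=> mf [IY Ym].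
  pose h y := (f (of_plane y))%:E.
  have mh : measurable_fun setT h by exact/measurable_EFinP.
  have hX : h \o (@to_plane R \o X) = EFin \o (fun t => f (X t)).
    by apply/funext => t; rewrite /h /= to_planeK.
  have hY : h \o (@to_plane R \o Y) = EFin \o (fun t => f (Y t)).
    by apply/funext => t; rewrite /h /= to_planeK.
  pose mu := pushforward P (@to_plane R \o X).
  pose nu := pushforward P' (@to_plane R \o Y).
  have nuY : nu.-integrable setT h.
    by apply: integrable_pushforward => //; rewrite preimage_setT hY.
  have munu (g : R * R -> \bar R) : (\int[mu]_y g y = \int[nu]_y g y)%E.
    by apply: eq_measure_integral => A mA _; exact: law.
  (* Integrability comes first: the integral of the modulus of [h] is the same under both image
     measures, hence finite. *)
  have IX : P.-integrable setT (h \o (@to_plane R \o X)).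
    apply/integrableP; split; first exact: measurableT_comp.
    have /integrableP[_] := nuY; rewrite -munu ge0_integral_pushforward//.
    exact: measurableT_comp.
  split; first by rewrite -hX.
  transitivity (\int[P]_t (h \o (@to_plane R \o X)) t)%E; first by rewrite hX.
  rewrite -[setT]/((@to_plane R \o X) @^-1` setT) -integral_pushforward// munu.
  by rewrite integral_pushforward ?preimage_setT ?hY.
by move=> [Yr Yi]; split; [apply: (step (fun z => complex.Re (F z)))
                          |apply: (step (fun z => complex.Im (F z)))].
Qed.
End IndependentProduct.

(** * Mixed moments of a variable with finite fourth moment *)

Section Moments.
Context {d : measure_display} {T : measurableType d} {R : realType}.
Set Implicit Arguments.
Unset Strict Implicit.
Unset Printing Implicit Defensive.
Variable P : probability T R.
Local Notation C := R[i].

Lemma normcX (z : C) n : Normc.normc (z ^+ n) = Normc.normc z ^+ n.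
Proof.
by elim: n => [|n IH]; rewrite ?expr0 ?Normc.normc1// !exprS Normc.normcM IH.
Qed.

Lemma normc_conj (z : C) : Normc.normc z^* = Normc.normc z.
Proof. by case: z => x y /=; rewrite sqrrN. Qed.

Lemma normc_ge0 (z : C) : 0 <= Normc.normc z.
Proof. by case: z => x y; exact: sqrtr_ge0. Qed.

Lemma ler_Re_normc (z : C) : `|complex.Re z| <= Normc.normc z.
Proof. by case: z => x y /=; rewrite -sqrtr_sqr ler_wsqrtr// lerDl sqr_ge0. Qed.

Lemma ler_Im_normc (z : C) : `|complex.Im z| <= Normc.normc z.
Proof. by case: z => x y /=; rewrite -sqrtr_sqr ler_wsqrtr// lerDr sqr_ge0. Qed.

Lemma sqr_normcE (z : C) : Normc.normc z ^+ 2 = complex.Re z ^+ 2 + complex.Im z ^+ 2.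
Proof. by case: z => x y /=; rewrite sqr_sqrtr// addr_ge0 ?sqr_ge0. Qed.

Lemma measurable_normc4 (X : T -> C) :
  complex_RV X -> measurable_fun setT (fun t => Normc.normc (X t) ^+ 4).
Proof.
move=> /complex_RVP[Xr Xi].
under eq_fun do rewrite (exprM _ 2 2) sqr_normcE.
by apply: measurable_funX; apply: measurable_funD; exact: measurable_funX.
Qed.

Lemma has_cexpectation_le (X : T -> C) (g : T -> R) : complex_RV X ->
  (forall t, Normc.normc (X t) <= g t) -> P.-integrable setT (EFin \o g) ->
  has_cexpectation P X (cexpectation P X).
Proof.
move=> /complex_RVP[Xr Xi] Xg Ig; split; apply: has_expectation_fine;
  apply: le_integrable Ig => //; try exact/measurable_EFinP;
  move=> t _ /=; rewrite lee_fin (le_trans _ (ler_norm _))// (le_trans _ (Xg t))//.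
- exact: ler_Re_normc.
- exact: ler_Im_normc.
Qed.

Definition moment (X : T -> C) a b : C :=
  cexpectation P (fun t => X t ^+ a * (X t)^* ^+ b).

(** The modulus [|X|^(a+b)] is at most 1 where [|X| <= 1] and at most [|X|^4] elsewhere, so
    [1 + |X|^4] dominates it. *)
Lemma has_cexpectation_moment (X : T -> C) a b : complex_RV X ->
  ('E_P[fun t => (Normc.normc (X t) ^+ 4)%R] < +oo)%E -> (a + b <= 4)%N ->
  has_cexpectation P (fun t => X t ^+ a * (X t)^* ^+ b) (moment X a b).
Proof.
move=> mX X4 ab.
have m4 := measurable_normc4 mX.
have I4 : P.-integrable setT (EFin \o (fun t => Normc.normc (X t) ^+ 4)).
  apply/integrableP; split; first exact/measurable_EFinP.
  move: X4; rewrite unlock; congr (_ < _)%E; apply: eq_integral => t _.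
  by rewrite /= ger0_norm ?exprn_ge0 ?normc_ge0.
apply: (has_cexpectation_le (g := fun t => 1 + Normc.normc (X t) ^+ 4)).
- apply: complex_RVM; apply: complex_RVX => //; exact: complex_RV_conj.
- move=> t; rewrite Normc.normcM !normcX normc_conj -exprD.
  set x := Normc.normc _; have x0 : 0 <= x by exact: normc_ge0.
  have [x1|x1] := leP x 1.
    by rewrite (@le_trans _ _ 1)// ?exprn_ile1// lerDl exprn_ge0.
  by rewrite (@le_trans _ _ (x ^+ 4))// ?lerDr// ler_eXn2l// ltW.
- have I1 : P.-integrable setT (EFin \o cst (1 : R)).
    exact: finite_measure_integrable_cst.
  exact: (integrableD measurableT I1 I4).
Qed.

Lemma has_cexpectationE (X : T -> C) v : has_cexpectation P X v -> cexpectation P X = v.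
Proof.
case: v => a b [[_ Xa] [_ Xb]].
by rewrite /cexpectation unlock Xa Xb.
Qed.

Lemma cexpectation_real (f : T -> R) :
  cexpectation P (fun t => (f t)%:C) = (fine ('E_P[f])%E)%:C.
Proof. by rewrite /cexpectation !unlock /= integral0. Qed.

Lemma moment00 (X : T -> C) : moment X 0 0 = 1.
Proof.
rewrite /moment (_ : (fun t => _) = fun=> 1).
  exact/has_cexpectationE/has_cexpectation_cst.
by apply/funext => t; rewrite !expr0 mulr1.
Qed.

(** The cases [a = 1] and [a = 2] give the second moment and the kurtosis. *)
Lemma moment_diag (X : T -> C) a :
  moment X a a = (fine ('E_P[fun t => (Normc.normc (X t) ^+ (2 * a))%R])%E)%:C.
Proof.
rewrite -cexpectation_real; congr (cexpectation P _); apply/funext => t.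
rewrite -exprMn -sqr_normc -exprM -[ `|X t|]/((Normc.normc (X t))%:C).
by rewrite -rmorphXn.
Qed.

Lemma moment_conj (X : T -> C) a b : complex_RV X ->
  ('E_P[fun t => (Normc.normc (X t) ^+ 4)%R] < +oo)%E -> (a + b <= 4)%N ->
  moment X b a = (moment X a b)^*.
Proof.
move=> mX X4 ab; apply: has_cexpectationE.
have := has_cexpectation_conj (has_cexpectation_moment mX X4 ab).
congr (has_cexpectation P _ _); apply/funext => t.
by rewrite rmorphM !rmorphXn /= conjCK mulrC.
Qed.

End Moments.

(** * Moments of the symbol vector *)

Section Symbols.
Context {R : realType} {N : nat}.
Set Implicit Arguments.
Unset Strict Implicit.
Unset Printing Implicit Defensive.
Local Notation C := R[i].
Variable I : {set 'I_N}.
Context {disp' : measure_display} {T' : measurableType disp'}.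
Variables (P' : probability T' R) (d : T' -> C).
Hypothesis d_RV : complex_RV d.
Hypothesis d4 : ('E_P'[fun t => (Normc.normc (d t) ^+ 4)%R] < +oo)%E.
Context {disp : measure_display} {T : measurableType disp}.
Variables (P : probability T R) (s : T -> 'cV[C]_N) (c : 'cV[C]_N).
Hypothesis pilot : forall i, i \in I -> forall t, s t i 0 = c i 0.
Hypothesis data : iid_copies P (~: I) (fun i t => s t i 0) P' d.

Definition symbol_moment i a b : C :=
  if i \in I then c i 0 ^+ a * (c i 0)^* ^+ b else moment P' d a b.

Lemma has_cexpectation_monomial (a b : 'I_N -> nat) : (forall i, a i + b i <= 4)%N ->
  has_cexpectation P (fun t => \prod_i (s t i 0 ^+ a i * (s t i 0)^* ^+ b i))
    (\prod_i symbol_moment i (a i) (b i)).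
Proof.
move=> ab; have [mX law indep] := data.
rewrite (bigID [in I])/=.
rewrite (_ : (fun t => _) = fun t =>
   \prod_(i in I) symbol_moment i (a i) (b i) *
   \prod_(i in ~: I) (s t i 0 ^+ a i * (s t i 0)^* ^+ b i)); last first.
  apply/funext => t; rewrite (bigID [in I])/=; congr (_ * _).
    by apply: eq_bigr => i iI; rewrite /symbol_moment iI pilot.
  by apply: eq_bigl => i; rewrite inE.
apply: has_cexpectationZ.
rewrite [X in has_cexpectation _ _ X](_ : _ =
   \prod_(i in ~: I) moment P' d (a i) (b i)); last first.
  by apply: eq_big => [i|i /negPf iI]; rewrite ?inE// /symbol_moment iI.
have mF i : complex_RV (fun y : R * R =>
    of_plane y ^+ a i * (of_plane y)^* ^+ b i).
  have m1 : complex_RV (@of_plane R) 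
    by apply/complex_RVP; split; [exact: measurable_fst|exact: measurable_snd].
  by apply: complex_RVM; apply: complex_RVX => //; exact: complex_RV_conj.
apply: (has_cexpectation_prod (X := fun i t => s t i 0)
   (F := fun i z => z ^+ a i * z^* ^+ b i)) => // i iI.
apply: (has_cexpectation_same_law (F := fun z => z ^+ a i * z^* ^+ b i)
  (mX i iI) d_RV (law i iI)) => //.
exact: has_cexpectation_moment.
Qed.

Lemma prod_expr_eq (K : comPzRingType) (x : 'I_N -> K) j :
  \prod_i x i ^+ (i == j) = x j.
Proof. by rewrite (bigD1 j)//= eqxx big1 ?mulr1// => i /negPf ->. Qed.

(** The exponents count how often [m] occurs unconjugated (as [i] or [l]) and conjugated (as [j] or
    [k]). Coinciding indices are thereby grouped, so that independence applies index by index. *)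
Lemma prod_quadruple (x : 'I_N -> C) (i j k l : 'I_N) :
  \prod_m (x m ^+ ((m == i) + (m == l)) * (x m)^* ^+ ((m == j) + (m == k)))
  = x i * (x j)^* * (x k * (x l)^*)^*.
Proof.
rewrite big_split/=.
under eq_bigr do rewrite exprD; rewrite big_split/= !prod_expr_eq.
under eq_bigr do rewrite exprD; rewrite big_split/=.
rewrite (prod_expr_eq (fun m => (x m)^*) j) (prod_expr_eq (fun m => (x m)^*) k).
by rewrite rmorphM /= conjCK; ring.
Qed.

Lemma has_cexpectation_quadruple (i j k l : 'I_N) :
  has_cexpectation P
    (fun t => s t i 0 * (s t j 0)^* * (s t k 0 * (s t l 0)^*)^*)
    (\prod_m symbol_moment m ((m == i) + (m == l)) ((m == j) + (m == k))).
Proof.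
under eq_fun do rewrite -(prod_quadruple (fun m => s _ m 0)).
(* Each exponent is a sum of two Booleans, so the degree at [m] is at most 4. *)
by apply: has_cexpectation_monomial => m; do 4 case: (_ == _).
Qed.

End Symbols.

(** * Roots of unity and the ambiguity function of an OFDM signal *)

Section Fourier.
Context {R : realType}.
Set Implicit Arguments.
Unset Strict Implicit.
Unset Printing Implicit Defensive.
Local Notation C := R[i].

Lemma expjD (a b : R) : expj (a + b) = expj a * expj b.
Proof. by rewrite /expj cosD sinD; simpc; rewrite [X in _ +i* X]addrC. Qed.

Lemma expj0 : expj (0 : R) = 1.
Proof. by rewrite /expj cos0 sin0. Qed.

Lemma expjN (a : R) : expj (- a) = (expj a)^*.
Proof. by rewrite /expj cosN sinN. Qed.

Lemma expjMn (a : R) n : expj (a *+ n) = expj a ^+ n.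
Proof. by elim: n => [|n IH]; rewrite ?mulr0n ?expj0// mulrS exprS expjD IH. Qed.

Lemma expj_unit (a : R) : expj a * (expj a)^* = 1.
Proof. by rewrite -expjN -expjD subrr expj0. Qed.

Variable N : nat.
Hypothesis N0 : (0 < N)%N.

Let N_neq0 : N%:R != 0 :> R. Proof. by rewrite pnatr_eq0 -lt0n. Qed.

Definition omega : C := expj (2 * pi / N%:R).

Lemma expj_omega (m n : nat) : expj (2 * pi * m%:R * n%:R / N%:R : R) = omega ^+ (m * n).
Proof. by rewrite -expjMn -[_ *+ (m * n)]mulr_natr natrM; congr expj; ring. Qed.

Lemma omegaJ n : omega ^+ n * (omega ^+ n)^* = 1.
Proof. by rewrite -expjMn expj_unit. Qed.

(** For [0 < n < N] the half angle [y = pi n / N] lies strictly between 0 and [pi], so [sin y > 0],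
    whereas [cos (2 y) = 1] forces [sin y = 0]. *)
Lemma omega_eq1 n : (n < N)%N -> omega ^+ n = 1 -> n = 0%N.
Proof.
move=> nN; rewrite -expjMn => -[cos1 _]; apply/eqP; rewrite -leqn0 leqNgt.
apply/negP => n0.
have y0 : 0 < pi * n%:R / N%:R :> R by rewrite divr_gt0 ?mulr_gt0 ?pi_gt0 ?ltr0n.
have ypi : pi * n%:R / N%:R < pi :> R.
  by rewrite ltr_pdivrMr ?ltr0n// ltr_pM2l ?pi_gt0// ltr_nat.
have : 0 < sin (pi * n%:R / N%:R : R) by apply: sin_gt0_pi; rewrite ?in_itv/= y0.
move: cos1; rewrite (_ : 2 * pi / N%:R *+ n = pi * n%:R / N%:R *+ 2 :> R); last first.
  by rewrite -[LHS]mulr_natr [RHS]mulr2n; ring.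
rewrite cos_mulr2n => /eqP; rewrite cos2sin2.
set z := sin _ => /eqP z1 z0.
have : z ^+ 2 = 0 by move: z1; lra.
by move/eqP; rewrite sqrf_eq0 => /eqP zz; move: z0; rewrite zz ltxx.
Qed.

Lemma omega_expN : omega ^+ N = 1.
Proof.
rewrite -expjMn -[2 * pi / N%:R *+ N]mulr_natr divfK// /expj mulr_natl.
by rewrite cos2pi sin2pi.
Qed.

Lemma omega_prim : N.-primitive_root omega.
Proof.
apply/andP; split=> //; apply/forallP => i; apply/eqP.
apply/unity_rootP/eqP => [om|->]; last exact: omega_expN.
apply/eqP; rewrite eqn_leq ltn_ord/= leqNgt; apply/negP => iN.
by have := omega_eq1 iN om.
Qed.

(** A geometric sum with ratio [z], an N-th root of unity: since [(z - 1)] times the sum is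
    [z^N - 1 = 0], it vanishes unless [z = 1], which by primitivity means that [a] and [b] are
    congruent. *)
Lemma omega_orthogonal a b :
  \sum_(n < N) omega ^+ (n * a) * (omega ^+ (n * b))^* = N%:R * (a == b %[mod N])%:R.
Proof.
pose z := omega ^+ a * (omega ^+ b)^*.
have -> : \sum_(n < N) omega ^+ (n * a) * (omega ^+ (n * b))^* = \sum_(n < N) z ^+ n.
  by apply: eq_bigr => n _; rewrite exprMn ![(n * _)%N]mulnC !exprM rmorphXn.
have zN : z ^+ N = 1.
  by rewrite exprMn -rmorphXn -!exprM ![(_ * N)%N]mulnC !exprM omega_expN !expr1n
    rmorph1 mulr1.
have z1 : (z == 1) = (a == b %[mod N]).
  rewrite -(eq_prim_root_expr omega_prim); apply/eqP/eqP => [z1|ab].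
    by rewrite -[LHS]mulr1 -(omegaJ b) mulrCA -/z z1 mulr1.
  by rewrite /z ab omegaJ.
have [ab|ab] := boolP (a == b %[mod N]).
  move: z1; rewrite ab => /eqP ->; rewrite mulr1.
  by under eq_bigr do rewrite expr1n; rewrite sumr_const card_ord.
rewrite mulr0; have := subrX1 z N; rewrite zN subrr => /esym/eqP.
by rewrite mulf_eq0 subr_eq0 z1 (negPf ab) => /eqP.
Qed.

Lemma subN_mod (n k : 'I_N) : subN n k + k = n %[mod N].
Proof. by rewrite /= modnDml -addnA subnK ?modnDr// ltnW. Qed.

(** Turns the cyclic difference into the subtraction-free congruence produced by
    [omega_orthogonal]. *)
Lemma eq_subN (m n k : 'I_N) : (m == subN n k) = (n == m + k %[mod N]).
Proof.
rewrite -val_eqE /= -(subN_mod n k) eqn_modDr eq_sym.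
by rewrite /= modn_mod [in RHS](modn_small (ltn_ord m)).
Qed.

Lemma ofdmE (s : 'cV[C]_N) n :
  ofdm s n 0 = (Num.sqrt N%:R)^-1%:C * \sum_(m < N) omega ^+ (m * n) * s m 0.
Proof.
rewrite mxE mulr_sumr; apply: eq_bigr => m _.
rewrite !mxE expjN expj_omega mulrA rmorphM /= conjCK; congr (_ * _ * _).
exact: conjc_real.
Qed.

Lemma omega_subN (m n k : 'I_N) :
  (omega ^+ (m * subN n k))^* = (omega ^+ (m * n))^* * omega ^+ (m * k).
Proof.
have : omega ^+ (m * n) = omega ^+ (m * subN n k) * omega ^+ (m * k).
  rewrite -exprD -mulnDr; apply/eqP; rewrite (eq_prim_root_expr omega_prim).
  by rewrite -[X in X == _]modnMmr -(subN_mod n k) modnMmr.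
by move=> ->; rewrite rmorphM -mulrA [X in _ * X]mulrC omegaJ mulr1.
Qed.

(* Cross-ambiguity of two OFDM signals: Fourier orthogonality only keeps the
   pairs of symbols whose indices differ by the Doppler shift. *)
Lemma ofdm_ambiguity (u v : 'cV[C]_N) (k q : 'I_N) :
  \sum_(n < N) (ofdm u (subN n k) 0)^* * ofdm v n 0 * (omega ^+ (q * n))^*
  = \sum_(m < N) v m 0 * (u (subN m q) 0)^* * omega ^+ (subN m q * k).
Proof.
(* The two DFT normalizations cancel the factor [N] coming from orthogonality. *)
have sqrtN : (Num.sqrt N%:R)^-1%:C * (Num.sqrt N%:R)^-1%:C * N%:R = 1 :> C.
  rewrite -(rmorph_nat (real_complex R)) -!rmorphM -expr2 exprVn sqr_sqrtr ?ler0n//.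
  by rewrite mulVf.
set r := _^-1%:C in sqrtN.
(* The last factor isolates the dependence on [n], so that summing over [n] first leaves only
   [l = subN m q]. *)
transitivity (\sum_(n < N) \sum_(m < N) \sum_(l < N)
    r * r * v m 0 * (u l 0)^* * omega ^+ (l * k)
    * (omega ^+ (n * m) * (omega ^+ (n * (l + q)))^*)).
  apply: eq_bigr => n _.
  have uE : (ofdm u (subN n k) 0)^*
      = r * \sum_(l < N) (omega ^+ (l * n))^* * omega ^+ (l * k) * (u l 0)^*.
    rewrite ofdmE rmorphM rmorph_sum; congr (_ * _); first exact: conjc_real.
    by apply: eq_bigr => l _; rewrite rmorphM /= omega_subN.
  rewrite uE ofdmE -/r.
  transitivity (r * r * (omega ^+ (q * n))^* * ((\sum_(m < N) omega ^+ (m * n) * v m 0)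
      * (\sum_(l < N) (omega ^+ (l * n))^* * omega ^+ (l * k) * (u l 0)^*))).
    by move: (\sum_(m < N) _) (\sum_(l < N) _) => x y; ring.
  rewrite big_distrlr/= mulr_sumr; apply: eq_bigr => m _.
  rewrite mulr_sumr; apply: eq_bigr => l _.
  rewrite mulnDr exprD rmorphM /= [(n * m)%N]mulnC [(n * l)%N]mulnC [(n * q)%N]mulnC.
  by move: (omega ^+ _) (omega ^+ _)^* => x y; ring.
rewrite exchange_big; apply: eq_bigr => m _.
rewrite exchange_big (bigD1 (subN m q))// -mulr_sumr omega_orthogonal.
rewrite -eq_subN eqxx big1 ?addr0 => [|l /= lm].
  rewrite mulr1 -[RHS](mul1r (_ * _ * _)) -[X in _ = X * _]sqrtN.
  by move: (omega ^+ _) => x; rewrite [LHS]addr0; ring.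
by rewrite -mulr_sumr omega_orthogonal -eq_subN (negPf lm) !mulr0.
Qed.

Lemma dpafE (x : 'cV[C]_N) (k q : 'I_N) :
  dpaf x k q = \sum_(n < N) (x (subN n k) 0)^* * x n 0 * (omega ^+ (q * n))^*.
Proof.
(* The shift matrix is real, hence [x^H R^T] is the conjugate transpose of [R x]. *)
have shiftJ : map_mx Num.conj (shift_mx R k) = shift_mx R k.
  by rewrite /shift_mx map_castmx map_block_mx !map_mx0 !map_mx1.
rewrite /dpaf -mulmxA.
have -> : x ^t* *m (shift_mx R k)^T = (shift_mx R k *m x) ^t*.
  by rewrite trmx_mul map_mxM -[map_mx _ (shift_mx R k)^T]map_trmx shiftJ.
rewrite mxE; apply: eq_bigr => n _; rewrite -shift_mxE.
move: (shift_mx R k *m x) => y; rewrite map_diag_mx mul_diag_mx !mxE.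
by rewrite expj_omega /=; ring.
Qed.

(* The sum inside the modulus in the definition of [psi]. *)
Definition ambiguity (s : 'cV[C]_N) (k q : 'I_N) : C :=
  \sum_(n < N) s n 0 * (s (subN n q) 0)^* * omega ^+ (n * k).

(** Modulo [N] the exponent [m k] splits as [(subN m q) k + q k]; the second term does not depend on
    [m] and gives the unimodular factor. *)
Lemma dpaf_ofdm (s : 'cV[C]_N) (k q : 'I_N) :
  dpaf (ofdm s) k q = (omega ^+ (q * k))^* * ambiguity s k q.
Proof.
rewrite dpafE ofdm_ambiguity mulr_sumr; apply: eq_bigr => m _.
have -> : omega ^+ (m * k) = omega ^+ (subN m q * k) * omega ^+ (q * k).
  rewrite -exprD -mulnDl; apply/eqP; rewrite (eq_prim_root_expr omega_prim).
  by rewrite -[X in X == _]modnMml -(subN_mod m q) modnMml.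
rewrite [RHS]mulrC -!mulrA; congr (_ * (_ * _)).
by rewrite omegaJ mulr1.
Qed.

Lemma normc_dpaf_ofdm (s : 'cV[C]_N) (k q : 'I_N) :
  Normc.normc (dpaf (ofdm s) k q) ^+ 2 = Normc.normc (ambiguity s k q) ^+ 2.
Proof.
apply: (@complexI R); rewrite !rmorphXn /=.
have sqrE (z : C) : (Normc.normc z)%:C ^+ 2 = z * z^* by exact: sqr_normc.
rewrite !sqrE dpaf_ofdm rmorphM /= conjCK mulrACA.
by rewrite [X in X * _]mulrC omegaJ mul1r.
Qed.

Lemma mulmx_DFT (s : 'cV[C]_N) : s ^t* *m DFT R N = (ofdm s) ^t*.
Proof. rewrite /ofdm; move: (DFT R N) => A; rewrite trmx_mul map_mxM; congr (_ *m _).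
by apply/matrixP => i j; rewrite !mxE /= conjCK. Qed.

(** Since [s^H F] is the conjugate transpose of [x = ofdm s], the form is [x^H Phi R x], the
    conjugate of the ambiguity function. *)
Lemma ofdm_ambiguity_form (s : 'cV[C]_N) (k q : 'I_N) :
  (s ^t* *m DFT R N *m phase_mx R q *m shift_mx R k *m (DFT R N) ^t* *m s) 0 0
  = (dpaf (ofdm s) k q)^*.
Proof.
rewrite mulmx_DFT -!mulmxA mulmxA dpafE rmorph_sum/=.
rewrite mxE; apply: eq_bigr => n _; rewrite -/(ofdm s) -shift_mxE.
move: (ofdm s) (shift_mx R k *m _) => x y.
by rewrite mul_mx_diag !mxE expj_omega !rmorphM /= !conjCK; ring.
Qed.

(** This is the zero-delay case of [ofdm_ambiguity], where the phases on the symbol side become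
    1. *)
Lemma ofdm_phase_form (s : 'cV[C]_N) (q : 'I_N) :
  (s ^t* *m DFT R N *m phase_mx R q *m (DFT R N) ^t* *m s) 0 0
  = (\sum_(n < N) s n 0 * (s (subN n q) 0)^*)^*.
Proof.
have := ofdm_ambiguity s s (Ordinal N0) q.
have subN0 n : subN n (Ordinal N0) = n.
  by apply: val_inj; rewrite /= subn0 modnDr modn_small.
under eq_bigr do rewrite subN0; under [in RHS]eq_bigr do rewrite muln0 expr0 mulr1.
move=> <-; rewrite mulmx_DFT -!mulmxA mulmxA rmorph_sum/=.
rewrite mxE; apply: eq_bigr => n _; rewrite -/(ofdm s).
move: (ofdm s) => x; rewrite mul_mx_diag !mxE expj_omega !rmorphM /= !conjCK; ring.
Qed.

End Fourier.

(** * Evaluation of the expected squared ambiguity function *)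

Section ExpectedAmbiguity.
Context {R : realType} {N : nat}.
Set Implicit Arguments.
Unset Strict Implicit.
Unset Printing Implicit Defensive.
Local Notation C := R[i].
Variable I : {set 'I_N}.
Context {disp' : measure_display} {T' : measurableType disp'}.
Variables (P' : probability T' R) (d : T' -> C).
Hypothesis d_RV : complex_RV d.
Hypothesis d4 : ('E_P'[fun t => (Normc.normc (d t) ^+ 4)%R] < +oo)%E.
Hypothesis d1 : cexpectation P' d = 0.
Hypothesis d2 : ('E_P'[fun t => (Normc.normc (d t) ^+ 2)%R] = 1)%E.
Hypothesis dd : cexpectation P' (fun t => d t ^+ 2) = 0.
Context {disp : measure_display} {T : measurableType disp}.
Variables (P : probability T R) (s : T -> 'cV[C]_N) (c : 'cV[C]_N).
Hypothesis pilot : forall i, i \in I -> forall t, s t i 0 = c i 0.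
Hypothesis unit_pilot : forall i, i \in I -> `|c i 0| = 1.
Hypothesis data : iid_copies P (~: I) (fun i t => s t i 0) P' d.

Local Notation sm := (symbol_moment I P' d c).
Local Notation p := (pilot_vec I c).
Local Notation om := (@omega R N).

Lemma symbol_moment00 i : sm i 0 0 = 1.
Proof. by rewrite /symbol_moment moment00 !expr0 mulr1 if_same. Qed.

Lemma symbol_moment11 i : sm i 1 1 = 1.
Proof.
rewrite /symbol_moment; case: ifPn => [iI|_].
  by rewrite !expr1 -[LHS]sqr_normc unit_pilot// expr1n.
by rewrite moment_diag muln1 d2.
Qed.

Lemma symbol_moment_r0 i a : i \notin I -> (0 < a <= 2)%N -> sm i a 0 = 0.
Proof.
move=> iI; rewrite /symbol_moment (negPf iI); case: a => [|[|[|//]]]// _.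
  by rewrite -[RHS]d1; congr (cexpectation P' _); apply/funext => t; rewrite expr0 mulr1.
by rewrite -[RHS]dd; congr (cexpectation P' _); apply/funext => t; rewrite expr0 mulr1.
Qed.

Lemma symbol_moment_l0 i b : i \notin I -> (0 < b <= 2)%N -> sm i 0 b = 0.
Proof.
move=> iI b2; have := symbol_moment_r0 iI b2; rewrite /symbol_moment (negPf iI).
rewrite (moment_conj (a := b) (b := 0))//; last first.
  by case/andP: b2 => _ /leq_trans; rewrite addn0; apply.
by move=> ->; rewrite rmorph0.
Qed.

Lemma subN_eq0 (n q : 'I_N) : q != 0%N :> nat -> (n == subN n q) = false.
Proof.
move=> q0; rewrite eq_subN -[X in X == _ %[mod _]]addn0 eqn_modDl mod0n.
by rewrite modn_small// eq_sym (negPf q0).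
Qed.

Lemma subN_inj (q : 'I_N) : injective (fun n : 'I_N => subN n q).
Proof.
move=> m n /= mn; apply/val_inj => /=.
by rewrite -(modn_small (ltn_ord m)) -(modn_small (ltn_ord n)) -(subN_mod m q) mn subN_mod.
Qed.

(** The indices [n] and [subN n' q] occur unconjugated, [subN n q] and [n'] conjugated, and no index
    of the first pair equals one of the second. A data index among them thus has one exponent 0 and
    the other 1 or 2, so its moment vanishes, as does [p] there; with pilots only, the moment is the
    value itself. *)
Lemma prod_symbol_moment_offdiag (n n' q : 'I_N) : q != 0%N :> nat -> n != n' ->
  \prod_m sm m ((m == n) + (m == subN n' q)) ((m == subN n q) + (m == n'))
  = p n 0 * (p (subN n q) 0)^* * (p n' 0 * (p (subN n' q) 0)^*)^*.
Proof.
move=> q0 nn'.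
have neq := (subN_eq0 _ q0).
have nn'q : (subN n q == subN n' q) = false by apply/negbTE/eqP => /subN_inj/eqP; apply/negP.
have [allI|] := boolP [&& n \in I, subN n q \in I, n' \in I & subN n' q \in I].
  have /and4P[nI nqI n'I n'qI] := allI.
  rewrite !mxE nI nqI n'I n'qI -(prod_quadruple (fun m => c m 0)).
  apply: eq_bigr => m _; have [mI|mI] := boolP (m \in I); first by rewrite /symbol_moment mI.
  have F j : j \in I -> (m == j) = false.
    by move=> jI; apply/negbTE; apply: contraNneq mI => ->.
  by rewrite !F// symbol_moment00 !expr0 mulr1.
(* The one comparison left undecided in each case only settles whether the nonzero exponent is 1 or
   2. *)
have zero i : i \notin I -> i \in [:: n; subN n q; n'; subN n' q] ->
    sm i ((i == n) + (i == subN n' q)) ((i == subN n q) + (i == n')) = 0.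
  move=> iI; rewrite !inE => /or4P[] /eqP E; move: iI; rewrite E => iI.
  - by rewrite neq (negPf nn') eqxx symbol_moment_r0//; case: (_ == _).
  - rewrite nn'q [_ == n]eq_sym neq eqxx symbol_moment_l0//; by case: (_ == _).
  - rewrite neq [_ == n]eq_sym (negPf nn') eqxx addn1 symbol_moment_l0//; by case: (_ == _).
  - rewrite [_ == n']eq_sym neq [_ == subN n q]eq_sym nn'q eqxx addn1 symbol_moment_r0//.
    by case: (_ == _).
have prod0 i : i \notin I -> i \in [:: n; subN n q; n'; subN n' q] ->
    \prod_m sm m ((m == n) + (m == subN n' q)) ((m == subN n q) + (m == n')) = 0.
  by move=> iI iE; rewrite (bigD1 i)//= zero// mul0r.
rewrite !negb_and => /or4P[] iI; rewrite (prod0 _ iI) ?inE ?eqxx ?orbT//;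
  by rewrite !mxE (negPf iI) ?(rmorph0, mul0r, mulr0).
Qed.

(** As [n] and [subN n q] differ, both exponents are 1 at these two indices and 0 elsewhere. *)
Lemma prod_symbol_moment_diag (n q : 'I_N) : q != 0%N :> nat ->
  \prod_m sm m ((m == n) + (m == subN n q)) ((m == subN n q) + (m == n)) = 1.
Proof.
move=> q0; apply: big1 => m _; rewrite [X in sm m _ X]addnC.
have [->|_] := eqVneq m n; first by rewrite subN_eq0//; exact: symbol_moment11.
by case: (_ == _); [exact: symbol_moment11|exact: symbol_moment00].
Qed.

Lemma symbol_moment22 i :
  sm i 2 2 = (if i \in I then 1 else kurtosis P' d)%:C.
Proof.
rewrite /symbol_moment; case: ifPn => [iI|_]; last exact: moment_diag.
by rewrite -exprMn -[c i 0 * _]sqr_normc unit_pilot// !expr1n.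
Qed.

(** Both exponents agree at every index; they reach 2 only at [n = n'], where a data symbol
    contributes the kurtosis instead of 1. *)
Lemma prod_symbol_moment_zero_doppler (n n' : 'I_N) :
  \prod_m sm m ((m == n) + (m == n')) ((m == n) + (m == n'))
  = 1 + (n == n')%:R * (if n \in I then 0 else kurtosis P' d - 1)%:C.
Proof.
have sm1 m (b : bool) : sm m b b = 1.
  by case: b; [exact: symbol_moment11 | exact: symbol_moment00].
have [<-|nn'] := eqVneq n n'; last first.
  rewrite mul0r addr0; apply: big1 => m _.
  have [->|] := eqVneq m n; first by rewrite (negPf nn') addn0 (sm1 n true).
  by rewrite add0n sm1.
rewrite (bigD1 n)//= eqxx big1 => [|m /negPf ->]; last exact: (sm1 m false).
by rewrite mulr1 mul1r symbol_moment22 -(rmorph1 (real_complex R)) -rmorphD; case: ifP => _;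
  rewrite ?addr0// addrC subrK.
Qed.

Lemma has_cexpectation_sqr_ambiguity (k q : 'I_N) :
  has_cexpectation P (fun t => (Normc.normc (ambiguity (s t) k q) ^+ 2)%:C)
    (\sum_(n < N) \sum_(n' < N) om ^+ (n * k) * (om ^+ (n' * k))^*
      * \prod_m sm m ((m == n) + (m == subN n' q)) ((m == subN n q) + (m == n'))).
Proof.
have -> : (fun t => (Normc.normc (ambiguity (s t) k q) ^+ 2)%:C) =
   (fun t => \sum_(n < N) \sum_(n' < N) om ^+ (n * k) * (om ^+ (n' * k))^*
     * (s t n 0 * (s t (subN n q) 0)^* * (s t n' 0 * (s t (subN n' q) 0)^*)^*)).
  apply/funext => t; rewrite rmorphXn.
  transitivity (ambiguity (s t) k q * (ambiguity (s t) k q)^*); first exact: sqr_normc.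
  rewrite /ambiguity rmorph_sum big_distrlr/=; apply: eq_bigr => n _; apply: eq_bigr => n' _.
  by rewrite rmorphM /=; move: (om ^+ _) (om ^+ _)^* => x y; ring.
apply: has_cexpectation_sum => n _; apply: has_cexpectation_sum => n' _.
apply: has_cexpectationZ.
exact: (has_cexpectation_quadruple d_RV d4 pilot data).
Qed.

(** Reduces both cases of the theorem to evaluating a deterministic double sum. *)
Lemma expectation_sqr_ambiguity (k q : 'I_N) (v : R) :
  \sum_(n < N) \sum_(n' < N) om ^+ (n * k) * (om ^+ (n' * k))^*
      * \prod_m sm m ((m == n) + (m == subN n' q)) ((m == subN n q) + (m == n')) = v%:C ->
  ('E_P[fun t => (Normc.normc (dpaf (ofdm (s t)) k q) ^+ 2)%R] = v%:E)%E.
Proof.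
move=> E; have := has_cexpectation_sqr_ambiguity k q; rewrite E => -[[_ Iv] _].
have N0 := ord_pos k.
by rewrite unlock -Iv; apply: eq_integral => t _; rewrite normc_dpaf_ofdm.
Qed.

Lemma expectation_zero_doppler (k q : 'I_N) : q = 0%N :> nat ->
  ('E_P[fun t => (Normc.normc (dpaf (ofdm (s t)) k q) ^+ 2)%R]
   = (N%:R ^+ 2 * (k == 0%N :> nat)%:R
      + (kurtosis P' d - 1) * (N%:R - #|I|%:R))%:E)%E.
Proof.
move=> q0; have N0 := ord_pos k; apply: expectation_sqr_ambiguity.
have subq n : subN n q = n by apply: val_inj; rewrite /= q0 subn0 modnDr modn_small.
pose e n := if n \in I then 0 else kurtosis P' d - 1.
(* The constant 1 in every moment yields the squared modulus of a sum of roots of unity; the excess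
   [e n] survives only at [n' = n], where the phases cancel. *)
transitivity (\sum_(n < N) (om ^+ (n * k) * (\sum_(n' < N) om ^+ (n' * k))^* + (e n)%:C)).
  apply: eq_bigr => n _.
  have -> : (e n)%:C = \sum_(n' < N) (if n' == n then (e n)%:C else 0).
    by rewrite -big_mkcond big_pred1_eq.
  rewrite rmorph_sum mulr_sumr.
  rewrite -big_split/=; apply: eq_bigr => n' _.
  rewrite !subq prod_symbol_moment_zero_doppler mulrDr mulr1; congr (_ + _).
  have [->|_] := eqVneq n' n; last by rewrite mul0r mulr0.
  by rewrite omegaJ !mul1r.
rewrite big_split/= -mulr_suml.
have -> : \sum_(n < N) om ^+ (n * k) = N%:R * (k == 0%N :> nat)%:R.
  have := omega_orthogonal (R := R) N0 k 0; rewrite mod0n modn_small// => <-.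
  by apply: eq_bigr => n _; rewrite muln0 expr0 rmorph1 mulr1.
rewrite rmorphM /= !conjC_nat -rmorph_sum rmorphD; congr (_ + _).
  rewrite rmorphM rmorphXn !rmorph_nat -mulrA; case: (_ == _); last by rewrite !mulr0.
  by rewrite !mulr1 mul1r.
congr (_%:C); rewrite /e; under eq_bigr do rewrite -if_neg.
rewrite -big_mkcond sumr_const -[LHS]mulr_natr; congr (_ * _).
rewrite -natrB; last by rewrite -[X in (_ <= X)%N]card_ord max_card.
have IN := cardC [in I]; rewrite card_ord in IN.
by rewrite -[X in (X - _)%N]IN addKn.
Qed.

Lemma expectation_nonzero_doppler (k q : 'I_N) : q != 0%N :> nat ->
  ('E_P[fun t => (Normc.normc (dpaf (ofdm (s t)) k q) ^+ 2)%R] = (psi I p k q)%:E)%E.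
Proof.
move=> q0; have N0 := ord_pos k; apply: expectation_sqr_ambiguity.
pose w := pilot_mask R I.
(* The off-diagonal formula is used for all pairs. At [n' = n] it gives [w n * w (subN n q)] instead
   of the true moment 1; the last summand corrects this. *)
transitivity (\sum_(n < N) ((om ^+ (n * k) * (p n 0 * (p (subN n q) 0)^*))
    * (ambiguity p k q)^* + (1 - w n 0 * w (subN n q) 0)%:C)).
  apply: eq_bigr => n _.
  have -> : (1 - w n 0 * w (subN n q) 0)%:C
      = \sum_(n' < N) (if n' == n then (1 - w n 0 * w (subN n q) 0)%:C else 0).
    by rewrite -big_mkcond big_pred1_eq.
  rewrite rmorph_sum mulr_sumr.
  rewrite -big_split/=; apply: eq_bigr => n' _.
  have [->|nn'] := eqVneq n' n; last first.
    rewrite prod_symbol_moment_offdiag// 1?eq_sym// addr0 !rmorphM /=.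
    by move: (om ^+ _) (om ^+ _)^* => x y; ring.
  rewrite prod_symbol_moment_diag// omegaJ mulr1.
  rewrite [X in _ = X + _](_ : _ = (w n 0 * w (subN n q) 0)%:C).
    by rewrite -rmorphD addrC subrK.
  rewrite !rmorphM /= [RHS](_ : _ =
    (p n 0 * (p n 0)^*) * (p (subN n q) 0 * (p (subN n q) 0)^*)).
    transitivity ((om ^+ (n * k) * (om ^+ (n * k))^*)
      * ((p n 0 * (p n 0)^*) * (p (subN n q) 0 * (p (subN n q) 0)^*))).
      by move: (om ^+ _) (om ^+ _)^* => x y; rewrite conjCK; ring.
    by rewrite omegaJ mul1r.
  have pw m : p m 0 * (p m 0)^* = (w m 0)%:C.
    rewrite !mxE; case: ifPn => [mI|_]; last by rewrite mul0r.
    by rewrite -[LHS]sqr_normc unit_pilot// expr1n.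
  by rewrite !pw.
rewrite big_split/= -mulr_suml.
have -> : \sum_(n < N) om ^+ (n * k) * (p n 0 * (p (subN n q) 0)^*) = ambiguity p k q.
  by apply: eq_bigr => n _; rewrite mulrC.
rewrite -[X in X + _]sqr_normc -rmorph_sum sumrB sumr_const card_ord /psi -addrA.
rewrite [RHS]rmorphD rmorphXn; congr (_ + _).
congr (((Normc.normc _)%:C : C) ^+ 2); apply: eq_bigr => n _.
by rewrite expj_omega.
Qed.

End ExpectedAmbiguity.

Theorem theorem1 (R : realType) (N L : nat) (hN : (1 <= N)%N) (hL : (L <= N)%N)
  (I : {set 'I_N}) (hI : #|I| = L)
  (* the generic data symbol *)
  (disp' : measure_display) (T' : measurableType disp') (P' : probability T' R)
  (d : T' -> R[i]) (hd : complex_RV d)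
  (hd4 : ('E_P'[fun t => (Normc.normc (d t) ^+ 4)%R] < +oo)%E)
  (hd1 : cexpectation P' d = 0)
  (hd2 : ('E_P'[fun t => (Normc.normc (d t) ^+ 2)%R] = 1)%E)
  (hdd : cexpectation P' (fun t => d t ^+ 2) = 0)
  (hd3 : cexpectation P' (fun t => d t * `|d t| ^+ 2) = 0)
  (hd3' : cexpectation P' (fun t => (d t)^* * `|d t| ^+ 2) = 0)
  (* the random symbol vector: pilots [c i] on [I], data elsewhere *)
  (disp : measure_display) (T : measurableType disp) (P : probability T R)
  (s : T -> 'cV[R[i]]_N) (c : 'cV[R[i]]_N)
  (hpilot : forall i, i \in I -> forall t, s t i 0 = c i 0)
  (hunit : forall i, i \in I -> `|c i 0| = 1)
  (hdata : iid_copies P (~: I) (fun i t => s t i 0) P' d) :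
  let kappa := kurtosis P' d in
  let p := pilot_vec I c in
  let w := pilot_mask (R[i]) I in
  (forall k q : 'I_N,
     ('E_P[fun t => (Normc.normc (dpaf (ofdm (s t)) k q) ^+ 2)%R]
      = (if q == 0%N :> nat
         then N%:R ^+ 2 * (k == 0%N :> nat)%:R + (kappa - 1) * (N%:R - L%:R)
         else psi I p k q)%:E)%E) /\
  (forall k q : 'I_N,
     (psi I p k q)%:C
     = `|(p ^t* *m DFT R N *m phase_mx R q *m shift_mx R k *m (DFT R N) ^t*
           *m p) 0 0| ^+ 2
       + N%:R - (w ^t* *m DFT R N *m phase_mx R q *m (DFT R N) ^t* *m w) 0 0).
Proof.
move=> kappa p w; split=> k q.
  have [q0|q0] := eqVneq (q : nat) 0%N.
    rewrite -hI; exact: (expectation_zero_doppler hd hd4 hd2 hpilot hunit hdata).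
  exact: (expectation_nonzero_doppler hd hd4 hd1 hd2 hdd hpilot hunit hdata).
rewrite ofdm_ambiguity_form (ofdm_phase_form hN).
(* Taking the modulus removes the conjugation and the unimodular factor. *)
have -> : `|(dpaf (ofdm p) k q)^*| ^+ 2 = (Normc.normc (ambiguity p k q) ^+ 2)%:C.
  by rewrite norm_conjC -(normc_dpaf_ofdm hN) rmorphXn.
rewrite /psi rmorphB rmorphD rmorph_nat; congr (_%:C + _ - _).
  congr (Normc.normc _ ^+ 2); apply: eq_bigr => n _.
  by rewrite expj_omega.
(* The mask has entries 0 and 1, so the conjugations have no effect. *)
rewrite !rmorph_sum; apply: eq_bigr => n _.
by rewrite !mxE !rmorphM /= conjCK !rmorph_nat mulrC.
Qed.
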